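(* Let $X$ be a real Hilbert space, let $m\in\{2,3,\ldots\}$, let $R_1,\ldots,R_m\colon X\to X$ be nonexpansive, and let $\lambda_1,\ldots,\lambda_m\in(0,1)$ satisfy $\sum_{i=1}^m\lambda_i=1$. Set $\overline{R}=\sum_{i=1}^m\lambda_iR_i$. Then $$\overline{\operatorname{ran}}(\operatorname{Id}-\overline{R})=\overline{\textstyle\sum_{i=1}^m\lambda_i\operatorname{ran}(\operatorname{Id}-R_i)}.$$ Consequently, $$\operatorname{v}_{\overline{R}}=P_{\overline{\sum_{i=1}^m\lambda_i\operatorname{ran}(\operatorname{Id}-R_i)}}(0)$$ and $$\|\operatorname{v}_{\overline{R}}\|\leq\Big\|\sum_{i=1}^m\lambda_i\operatorname{v}_{R_i}\Big\|\leq\sum_{i=1}^m\lambda_i\|\operatorname{v}_{R_i}\|.$$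
   Context: $X$ is a real Hilbert space with induced norm $\|\cdot\|$; $\operatorname{Id}$ is the identity on $X$; sums and scalar multiples of sets are in the Minkowski sense; $\overline{\operatorname{ran}}(T)$ is the norm closure of the range $\operatorname{ran}(T)$ of $T$ (the bar in $\overline{R}$ is just notation for the convex combination). A map $R\colon X\to X$ is nonexpansive if $\|Rx-Ry\|\leq\|x-y\|$ for all $x,y\in X$. For a nonempty closed convex set $C\subseteq X$, $P_C$ is the metric projection onto $C$. For $R$ nonexpansive, $\overline{\operatorname{ran}}(\operatorname{Id}-R)$ is nonempty, closed and convex, and the minimal displacement vector of $R$ is $\operatorname{v}_R=P_{\overline{\operatorname{ran}}(\operatorname{Id}-R)}(0)$. *)

(* Defs.v *)
From HB Require Import structures.
From mathcomp Require Import all_boot all_order all_algebra.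
From mathcomp Require Import sesquilinear.
From mathcomp Require Import all_classical all_reals all_analysis.

Set Implicit Arguments.
Unset Strict Implicit.
Unset Printing Implicit Defensive.

Import Order.TTheory GRing.Theory Num.Theory.
Import numFieldNormedType.Exports.

Local Open Scope classical_set_scope.
Local Open Scope ring_scope.

(* A real Hilbert space is a complete normed module X over the reals together
   with a positive definite symmetric bilinear form [dot : {dot X for idfun}]
   inducing its norm. *)
Definition induces_norm (R : realType) (X : completeNormedModType R)
    (dot : {dot X for idfun}) : Prop :=
  forall x : X, `|x| = Num.sqrt (dot x x).

Definition nonexpansive (R : realType) (X : normedModType R) (T : X -> X) :
    Prop :=
  forall x y : X, `|T x - T y| <= `|x - y|.

Definition ran_Id_sub (R : realType) (X : normedModType R) (T : X -> X) :
    set X :=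
  range (fun x : X => x - T x).

Definition scale_set (R : realType) (X : normedModType R) (a : R)
    (A : set X) : set X :=
  [set a *: x | x in A].

Definition minkowski_sum (R : realType) (X : normedModType R) (m : nat)
    (A : 'I_m -> set X) : set X :=
  [set \sum_(i < m) z i | z in [set z : 'I_m -> X | forall i, A i (z i)]].

Definition is_metric_proj (R : realType) (X : normedModType R) (C : set X)
    (x p : X) : Prop :=
  C p /\ forall c, C c -> `|x - p| <= `|x - c|.

(* [get] picks an element satisfying the predicate if there is one, and an
   arbitrary point otherwise. In a Hilbert space, for C nonempty, closed and
   convex, exactly one point satisfies [is_metric_proj C x]. *)
Definition metric_proj (R : realType) (X : normedModType R) (C : set X)
    (x : X) : X :=
  get [set p | is_metric_proj C x p].

Definition min_displacement (R : realType) (X : normedModType R)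
    (T : X -> X) : X :=
  metric_proj (closure (ran_Id_sub T)) 0.

(* Main.v *)
Require Import Defs.
From HB Require Import structures.
From mathcomp Require Import all_boot all_order all_algebra.
From mathcomp Require Import sesquilinear.
From mathcomp Require Import all_classical all_reals all_analysis.
From mathcomp Require Import lra ring.

Set Implicit Arguments.
Unset Strict Implicit.
Unset Printing Implicit Defensive.

Import Order.TTheory GRing.Theory Num.Theory.
Import numFieldNormedType.Exports.

Local Open Scope classical_set_scope.
Local Open Scope ring_scope.

(** Put [A = Id - T] with [T] nonexpansive.  [A] is 1/2-cocoercive, hence
    rectangular: [<z, A z - A x> >= - |x|^2 / 2] for all [z], and this bound
    survives convex combinations.  Conversely, if [<z, A z - y>] is bounded
    below by [- c] uniformly in [z], then [y] is in the closure of [ran A]: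
    the solution [x_e] of [e x + A x = y], which exists by Banach's fixed point
    theorem, satisfies [e |x_e|^2 <= c], so that [y - A x_e = e x_e] tends to 0
    with [e] (the Brezis-Haraux argument).  This gives the range formula, and
    also that midpoints of [ran A] are in its closure, hence the existence of
    the element of minimal norm. *)

Lemma closure_normP (R : realType) (X : normedModType R) (E : set X) (p : X) :
  closure E p <-> forall e : R, 0 < e -> exists2 x, E x & `|p - x| < e.
Proof.
split=> [clEp e e0|Ep B].
  have [x [Ex]] := clEp _ (nbhsx_ballx p e e0).
  by rewrite -ball_normE; exists x.
move=> /nbhs_ballP[e /= e0 peB]; have [x Ex xe] := Ep _ e0.
by exists x; split => //; apply: peB; rewrite -ball_normE.
Qed.

Lemma sqr_normE (R : realType) (X : completeNormedModType R)
    (dot : {dot X for idfun}) (dot_norm : induces_norm dot) (x : X) :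
  `|x| ^+ 2 = dot x x.
Proof.
rewrite dot_norm sqr_sqrtr//.
have [->|x0] := eqVneq x 0; first by rewrite linear0l.
by rewrite ltW// neq0_dnorm_gt0.
Qed.

Lemma dotC (R : realType) (X : completeNormedModType R)
    (dot : {dot X for idfun}) (x y : X) : dot x y = dot y x.
Proof. by rewrite hermC /= expr0 mul1r. Qed.

Lemma dotZr (R : realType) (X : completeNormedModType R)
    (dot : {dot X for idfun}) (a : R) (x y : X) : dot x (a *: y) = a * dot x y.
Proof. by rewrite linearZr_LR. Qed.

Lemma dotBr (R : realType) (X : completeNormedModType R)
    (dot : {dot X for idfun}) (x y z : X) : dot x (y - z) = dot x y - dot x z.
Proof. by rewrite linearBr. Qed.

Lemma sqr_normD (R : realType) (X : completeNormedModType R)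
    (dot : {dot X for idfun}) (dot_norm : induces_norm dot) (x y : X) :
  `|x + y| ^+ 2 = `|x| ^+ 2 + `|y| ^+ 2 + 2 * dot x y.
Proof.
rewrite !(sqr_normE dot_norm) linearDl /= !linearDr /= (dotC dot y x); ring.
Qed.

(** With [u] the difference of displacements, [T x - T y = (x - y) - u]; expanding the square in
    nonexpansiveness cancels [|x - y|^2]. *)
Lemma nonexpansive_cocoercive (R : realType) (X : completeNormedModType R)
    (dot : {dot X for idfun}) (dot_norm : induces_norm dot)
    (T : X -> X) (T_nonexp : nonexpansive T) (x y : X) :
  `|(x - T x) - (y - T y)| ^+ 2
    <= 2 * dot (x - y) ((x - T x) - (y - T y)).
Proof.
set u := (x - T x) - _.
have Tu : T x - T y = (x - y) + - u.
  have -> : u = (x - y) - (T x - T y) by rewrite /u opprD addrACA -opprD.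
  by rewrite subKr.
have : `|T x - T y| ^+ 2 <= `|x - y| ^+ 2 by rewrite ler_sqr ?nnegrE.
rewrite Tu (sqr_normD dot_norm) linearNr normrN; lra.
Qed.

(** Cocoercivity gives [<z, u> >= |u|^2 / 2 + <x, u>], and the right side equals
    [(|x + u|^2 - |x|^2) / 2]. *)
Lemma nonexpansive_rectangular (R : realType) (X : completeNormedModType R)
    (dot : {dot X for idfun}) (dot_norm : induces_norm dot)
    (T : X -> X) (T_nonexp : nonexpansive T) (x z : X) :
  - (`|x| ^+ 2 / 2) <= dot z ((z - T z) - (x - T x)).
Proof.
have := nonexpansive_cocoercive dot_norm T_nonexp z x.
set u := (z - T z) - _; rewrite linearBl /= => coc.
have := sqr_ge0 `|x + u|; rewrite (sqr_normD dot_norm); lra.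
Qed.

(** The equation says that [x] is a fixed point of [x |-> (T x + y) / (1 + e)], a contraction with
    constant [1 / (1 + e)]. *)
Lemma nonexpansive_resolvent (R : realType) (X : completeNormedModType R)
    (T : X -> X) (T_nonexp : nonexpansive T) (e : R) (e0 : 0 < e) (y : X) :
  exists x, y = e *: x + (x - T x).
Proof.
have e1 : 0 < 1 + e by lra.
pose f := fun x => (1 + e)^-1 *: (T x + y).
have q0 : 0 <= (1 + e)^-1 by rewrite invr_ge0 ltW.
have fctr : is_contraction (totalfun f : {fun setT >-> setT}).
  exists (NngNum q0); split => /=; first by rewrite invf_lt1 //; lra.
  move=> [x1 x2] _ /=; rewrite /f -scalerBr normrZ ger0_norm// ler_wpM2l//.
  by rewrite opprD addrACA subrr addr0; exact: T_nonexp.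
have [||x _] := banach_fixed_point fctr; first exact: closedT.
  by exists 0.
move=> /= /(congr1 (fun v => (1 + e) *: v)); rewrite /f scalerA divff ?gt_eqF//.
rewrite scale1r scalerDl scale1r => xE; exists x.
by rewrite addrA [_ + x]addrC xE addrAC subrr add0r.
Qed.

Lemma closure_ran_Id_sub (R : realType) (X : completeNormedModType R)
    (dot : {dot X for idfun}) (dot_norm : induces_norm dot)
    (T : X -> X) (T_nonexp : nonexpansive T) (y : X) (c : R) :
  (forall z, - c <= dot z ((z - T z) - y)) -> closure (ran_Id_sub T) y.
Proof.
move=> yc; apply/closure_normP => d d0.
have c1 : 0 < `|c| + 1 by rewrite ltr_wpDl.
(* This [e] makes [|e x|^2 <= e c < e (|c| + 1) = d^2]; the summand 1 keeps the denominator
   positive. *)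
have e0 : 0 < d ^+ 2 / (`|c| + 1) by rewrite divr_gt0 ?exprn_gt0.
set e := d ^+ 2 / _ in e0.
have [x yE] := nonexpansive_resolvent T_nonexp e0 y.
exists (x - T x); first by exists x.
rewrite yE addrK -ltr_sqr ?nnegrE ?(ltW d0)//.
rewrite normrZ exprMn (sqr_normE dot_norm) gtr0_norm//.
have := yc x; rewrite yE opprD addrCA subrr addr0 linearNr /= dotZr => xc.
have -> : d ^+ 2 = e * (`|c| + 1) by rewrite mulfVK ?gt_eqF.
rewrite expr2 -mulrA ltr_pM2l//; have := ler_norm c; lra.
Qed.

(** Averaging the rectangularity bounds at [x] and [y] bounds the pairing with the midpoint from
    below, uniformly in [z]. *)
Lemma midpoint_closure_ran_Id_sub (R : realType) (X : completeNormedModType R)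
    (dot : {dot X for idfun}) (dot_norm : induces_norm dot)
    (T : X -> X) (T_nonexp : nonexpansive T) (a b : X) :
  ran_Id_sub T a -> ran_Id_sub T b ->
  closure (ran_Id_sub T) (2^-1 *: (a + b)).
Proof.
move=> [x _ <-] [y _ <-].
apply: (closure_ran_Id_sub dot_norm T_nonexp
  (c := (`|x| ^+ 2 + `|y| ^+ 2) / 4)).
move=> z.
have := nonexpansive_rectangular dot_norm T_nonexp x z.
have := nonexpansive_rectangular dot_norm T_nonexp y z.
rewrite !(dotBr _ _ (z - T z)) dotZr linearDr /=; lra.
Qed.

(** The projection theorem at 0, with approximate midpoints in place of convexity: a minimizing
    sequence in [E] is Cauchy, and its limit has norm at most the infimum [d]. *)
Lemma min_norm_closure (R : realType) (X : completeNormedModType R)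
    (dot : {dot X for idfun}) (dot_norm : induces_norm dot) (E : set X) :
  E !=set0 -> (forall a b, E a -> E b -> closure E (2^-1 *: (a + b))) ->
  exists p, is_metric_proj (closure E) 0 p.
Proof.
move=> E0 Emid.
pose d := inf [set `|x| | x in E].
have hinf : has_inf [set `|x| | x in E].
  split; first by have [x Ex] := E0; exists `|x|, x.
  by exists 0 => _ [x _ <-].
have d0 : 0 <= d by apply: lb_le_inf; [exact: hinf.1 | move=> _ [x _ <-]].
have dE x : E x -> d <= `|x|.
  by move=> Ex; apply: ge_inf; [exact: hinf.2 | exists x].
have dclE x : closure E x -> d <= `|x|.
  move=> /closure_normP Ex; apply/ler_addgt0Pr => e e0.
  have [y /dE dy xy] := Ex _ e0.
  have := lerB_dist y x; rewrite distrC; lra.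
have /choice[c cP] (n : nat) :
    exists x, E x /\ `|x| ^+ 2 < d ^+ 2 + n.+1%:R^-1.
  set r : R := n.+1%:R^-1; have r0 : 0 < r by rewrite invr_gt0.
  have dr : 0 <= d ^+ 2 + r by rewrite addr_ge0 ?sqr_ge0 ?ltW.
  (* The margin above the infimum that turns a bound on the norm into the wanted bound on its
     square. *)
  have sd0 : 0 < Num.sqrt (d ^+ 2 + r) - d.
    rewrite subr_gt0 -ltr_sqr ?nnegrE ?sqrtr_ge0// sqr_sqrtr//; lra.
  have [_ [x Ex <-]] := inf_adherent sd0 hinf.
  rewrite -/d addrC subrK => xd; exists x; split => //.
  by rewrite -(sqr_sqrtr dr) ltr_sqr ?nnegrE ?sqrtr_ge0.
(* Two such errors, each doubled by the parallelogram law, add up to less than [e ^+ 2]. *)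
have small (e : R) : 0 < e -> \forall n \near \oo, n.+1%:R^-1 < e ^+ 2 / 4.
  move=> e0; apply: near_infty_natSinv_lt (PosNum _).
  by rewrite divr_gt0 ?exprn_gt0.
have cc : cauchy (c @ \oo).
  apply: cauchy_exP => e e0.
  have [N _ smallN] := small _ e0.
  exists (c N); exists N => // n /= Nn.
  rewrite -ball_normE /= -ltr_sqr ?nnegrE ?(ltW e0)//.
  have [[EN cN] [En cn]] := (cP N, cP n).
  have := smallN N (leqnn N); have := smallN n Nn => /=.
  (* parallelogram law, the midpoint having norm at least d *)
  have := dclE _ (Emid _ _ EN En).
  rewrite -ler_sqr ?nnegrE// normrZ exprMn ger0_norm ?invr_ge0//.
  rewrite !(sqr_normD dot_norm) linearNr normrN /=.
  move: (N.+1%:R^-1 : R) (n.+1%:R^-1 : R) cN cn => r s cN cn.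
  rewrite expr2; lra.
have cvgc : cvgn c by exact/cauchy_cvgP.
have cp (e : R) : 0 < e -> \forall n \near \oo, `|limn c - c n| < e.
  by move=> e0; move/cvgrPdist_lt: cvgc; apply.
exists (limn c); split.
  apply/closure_normP => e /cp[N _ /(_ N (leqnn N)) /= pN].
  by exists (c N) => //; have [] := cP N.
move=> x /dclE dx; rewrite !sub0r !normrN; apply: le_trans dx.
apply/ler_addgt0Pr => e e0.
have e20 : 0 < e / 2 by lra.
near \oo => n.
have pn : `|limn c - c n| < e / 2 by near: n; exact: cp.
have : n.+1%:R^-1 < (e / 2) ^+ 2 / 4 by near: n; exact: small.
have [_ cn] := cP n => sn.
(* As [d] and [e] are nonnegative, [d^2 + (e / 2)^2 / 4 <= (d + e / 2)^2]. *)
have {}cn : `|c n| < d + e / 2.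
  have := mulr_ge0 d0 (ltW e20); have := sqr_ge0 (e / 2).
  rewrite -ltr_sqr ?nnegrE ?addr_ge0 ?(ltW e20)// sqrrD.
  move: (n.+1%:R^-1 : R) sn cn => r sn cn; lra.
have := lerB_dist (limn c) (c n); lra.
Unshelve. all: by end_near.
Qed.

(** Existence of a projection ensures that [get] does not return its default value. *)
Lemma min_displacementP (R : realType) (X : completeNormedModType R)
    (dot : {dot X for idfun}) (dot_norm : induces_norm dot)
    (T : X -> X) (T_nonexp : nonexpansive T) :
  is_metric_proj (closure (ran_Id_sub T)) 0 (min_displacement T).
Proof.
have [||p pP] := @min_norm_closure _ _ _ dot_norm (ran_Id_sub T).
- by exists (0 - T 0), 0.
- exact: midpoint_closure_ran_Id_sub.
exact: (getI pP).
Qed.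

Lemma ler_norm_convex_comb (R : realType) (X : normedModType R) (m : nat)
    (lambda : 'I_m -> R) (lambda0 : forall i, 0 <= lambda i) (x : 'I_m -> X) :
  `|\sum_(i < m) lambda i *: x i| <= \sum_(i < m) lambda i * `|x i|.
Proof.
apply: le_trans (ler_norm_sum _ _ _) _.
by apply: ler_sum => i _; rewrite normrZ ger0_norm.
Qed.

Lemma nonexpansive_convex_comb (R : realType) (X : normedModType R) (m : nat)
    (T : 'I_m -> X -> X) (T_nonexp : forall i, nonexpansive (T i))
    (lambda : 'I_m -> R) (lambda0 : forall i, 0 <= lambda i)
    (sum_lambda : \sum_(i < m) lambda i = 1) :
  nonexpansive (fun x => \sum_(i < m) lambda i *: T i x).
Proof.
move=> x y; rewrite -sumrB.
under eq_bigr do rewrite -scalerBr.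
apply: le_trans (ler_norm_convex_comb lambda0 _) _.
rewrite -[leRHS]mul1r -sum_lambda mulr_suml.
by apply: ler_sum => i _; rewrite ler_wpM2l//; exact: T_nonexp.
Qed.

Lemma Id_sub_convex_comb (R : realType) (X : normedModType R) (m : nat)
    (T : 'I_m -> X -> X) (lambda : 'I_m -> R)
    (sum_lambda : \sum_(i < m) lambda i = 1) (x : X) :
  x - \sum_(i < m) lambda i *: T i x = \sum_(i < m) lambda i *: (x - T i x).
Proof.
under [RHS]eq_bigr do rewrite scalerBr.
by rewrite sumrB -scaler_suml sum_lambda scale1r.
Qed.

Lemma closure_scale_sum (R : realType) (X : normedModType R) (m : nat)
    (lambda : 'I_m -> R) (lambda0 : forall i, 0 <= lambda i)
    (sum_lambda : \sum_(i < m) lambda i = 1)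
    (E : 'I_m -> set X) (p : 'I_m -> X) :
  (forall i, closure (E i) (p i)) ->
  closure (minkowski_sum (fun i => scale_set (lambda i) (E i)))
    (\sum_(i < m) lambda i *: p i).
Proof.
move=> pE; apply/closure_normP => e e0.
(* Halving [e] leaves room for the sum to be bounded termwise by non-strict inequalities. *)
have /choice[x xP] i : exists x, E i x /\ `|p i - x| < e / 2.
  have e20 : 0 < e / 2 by lra.
  by have /closure_normP/(_ _ e20)[x] := pE i; exists x.
exists (\sum_(i < m) lambda i *: x i).
  exists (fun i => lambda i *: x i) => //= i.
  by exists (x i) => //; have [] := xP i.
rewrite -sumrB; under eq_bigr do rewrite -scalerBr.
apply: le_lt_trans (ler_norm_convex_comb lambda0 _) _.
apply: (@le_lt_trans _ _ (\sum_(i < m) lambda i * (e / 2))).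
  by apply: ler_sum => i _; rewrite ler_wpM2l// ltW//; have [] := xP i.
rewrite -mulr_suml sum_lambda; lra.
Qed.

(** The hard inclusion: the base points [x i] may differ, but the rectangularity bounds at them,
    weighted by [lambda i], add up to one bound uniform in [w]. *)
Lemma minkowski_sum_sub_closure (R : realType) (X : completeNormedModType R)
    (dot : {dot X for idfun}) (dot_norm : induces_norm dot) (m : nat)
    (T : 'I_m -> X -> X) (T_nonexp : forall i, nonexpansive (T i))
    (lambda : 'I_m -> R) (lambda0 : forall i, 0 <= lambda i)
    (sum_lambda : \sum_(i < m) lambda i = 1) :
  minkowski_sum (fun i => scale_set (lambda i) (ran_Id_sub (T i)))
    `<=` closure (ran_Id_sub (fun x => \sum_(i < m) lambda i *: T i x)).
Proof.
move=> _ [z zP <-].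
have /choice[x xP] i : exists x, z i = lambda i *: (x - T i x).
  by have [_ [x _ <-] <-] := zP i; exists x.
apply: (closure_ran_Id_sub dot_norm
  (nonexpansive_convex_comb T_nonexp lambda0 sum_lambda)
  (c := \sum_(i < m) lambda i * (`|x i| ^+ 2 / 2))) => w.
rewrite Id_sub_convex_comb// -sumrB linear_sumr/= -sumrN; apply: ler_sum => i _.
rewrite xP -scalerBr dotZr -mulrN ler_wpM2l//.
exact: nonexpansive_rectangular.
Qed.

Theorem theorem5p1 (R : realType) (X : completeNormedModType R)
    (dot : {dot X for idfun}) (dot_norm : induces_norm dot)
    (m : nat) (m_ge2 : (2 <= m)%N)
    (T : 'I_m -> X -> X) (T_nonexp : forall i, nonexpansive (T i))
    (lambda : 'I_m -> R) (lambda01 : forall i, 0 < lambda i < 1)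
    (sum_lambda : \sum_(i < m) lambda i = 1) :
  let Tbar : X -> X := fun x => \sum_(i < m) lambda i *: T i x in
  let S : set X :=
    closure (minkowski_sum
      (fun i => scale_set (lambda i) (ran_Id_sub (T i)))) in
  [/\ closure (ran_Id_sub Tbar) = S,
      min_displacement Tbar = metric_proj S 0,
      `|min_displacement Tbar|
        <= `|\sum_(i < m) lambda i *: min_displacement (T i)| &
      `|\sum_(i < m) lambda i *: min_displacement (T i)|
        <= \sum_(i < m) lambda i * `|min_displacement (T i)|].
Proof.
move=> Tbar S.
have lambda0 i : 0 <= lambda i by rewrite ltW//; have /andP[] := lambda01 i.
have Tbar_nonexp : nonexpansive Tbar by exact: nonexpansive_convex_comb.
have clE : closure (ran_Id_sub Tbar) = S.
  apply/seteqP; split.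
    (* The easy inclusion: the same base point [x] serves in every summand. *)
    apply: closureS => _ [x _ <-]; rewrite Id_sub_convex_comb//.
    exists (fun i => lambda i *: (x - T i x)) => //= i.
    by exists (x - T i x) => //; exists x.
  rewrite [X in _ `<=` X](closure_id _).1; last exact: closed_closure.
  exact/closureS/(minkowski_sum_sub_closure dot_norm).
split => //; first by rewrite /min_displacement clE.
  (* The minimality of the displacement vector of [Tbar] is tested against the combination of the
     individual ones, a point of [S]. *)
  have [_] := min_displacementP dot_norm Tbar_nonexp.
  move=> /(_ (\sum_(i < m) lambda i *: min_displacement (T i))).
  rewrite !sub0r !normrN; apply; rewrite clE; apply: closure_scale_sum => // i.
  by have [] := min_displacementP dot_norm (T_nonexp i).
exact: ler_norm_convex_comb.
Qed.
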